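(* Let $\beta>1$ be a real number. The following conditions are equivalent: (1) the set $Z_{\beta,M}$ is recognizable by a finite Büchi automaton for every positive integer $M$; (2) the set $Z_{\beta,M}$ is recognizable by a finite Büchi automaton for one (i.e. for at least one) integer $M\ge\lceil\beta\rceil-1$; (3) $\beta$ is a Pisot number.
   Context: For an integer $M\ge 1$, $Z_{\beta,M}=\{z_1z_2\cdots \mid z_i\in\{-M,\ldots,M\},\ \sum_{i\ge 1}z_i\beta^{-i}=0\}$ is the set of infinite words over $\{-M,\dots,M\}$ with value $0$ in base $\beta$. A Pisot number is a real algebraic integer greater than $1$ all of whose other Galois conjugates have modulus less than $1$. An automaton over a finite alphabet $B$ is a directed graph with edges labeled by letters of $B$, with a set $Q$ of states, a set $I\subseteq Q$ of initial states and a set $T\subseteq Q$ of terminal states; it is finite if $Q$ is finite. An infinite path is successful if it starts in $I$ and goes infinitely often through $T$. The set of infinite words recognized by the (Büchi) automaton is the set of labels of its successful infinite paths. A set of infinite words over $B$ is recognizable by a finite Büchi automaton if it is the set recognized by some finite such automaton (not necessarily deterministic). *)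

(* Defs.v *)
From HB Require Import structures.
From mathcomp Require Import all_boot all_order all_algebra.
From mathcomp Require Import all_classical all_reals all_analysis.
From mathcomp Require Import complex.

Set Implicit Arguments.
Unset Strict Implicit.
Unset Printing Implicit Defensive.

Import Order.TTheory GRing.Theory Num.Theory.
Import numFieldNormedType.Exports.

Local Open Scope classical_set_scope.
Local Open Scope ring_scope.

Record digit (M : nat) := Digit {
  digit_val :> int;
  digit_valP : - M%:Z <= digit_val <= M%:Z }.

HB.instance Definition _ M := [isSub for @digit_val M].
HB.instance Definition _ M := [Countable of digit M by <:].

Definition ord_of_digit M (z : digit M) : 'I_(M + M).+1 :=
  inord (absz ((z : int) + M%:Z)).

Definition digit_of_ord M (i : 'I_(M + M).+1) : option (digit M) :=
  insub ((i : nat)%:Z - M%:Z).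

Lemma ord_of_digitK M : pcancel (@ord_of_digit M) (@digit_of_ord M).
Proof.
move=> z; have /andP[lez zle] := digit_valP z.
have z0 : 0 <= (z : int) + M%:Z by rewrite -lerBlDr sub0r.
have zM : (absz ((z : int) + M%:Z)%R < (M + M).+1)%N.
  by rewrite ltnS -lez_nat gez0_abs// PoszD lerD2r.
rewrite /digit_of_ord /ord_of_digit inordK// gez0_abs// addrK.
by rewrite (valK z).
Qed.

HB.instance Definition _ M :=
  fintype.isFinite.Build (digit M) (pcan_enumP (@ord_of_digitK M)).

(* Words are indexed from 0: the letter written z_i for i >= 1 is [w i.-1]. *)
Definition infinite_word (B : Type) := nat -> B.

Record finite_automaton (B : finType) := FiniteAutomaton {
  state : finType;
  edges : {set state * B * state};
  initial : {set state};
  terminal : {set state} }.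

Section Buchi.
Context {B : finType}.

Definition infinite_path (A : finite_automaton B) (w : infinite_word B)
    (q : nat -> state A) : Prop :=
  forall i, (q i, w i, q i.+1) \in edges A.

Definition successful (A : finite_automaton B) (q : nat -> state A) : Prop :=
  q 0%N \in initial A /\
  forall n, exists2 m, (n <= m)%N & q m \in terminal A.

Definition recognized (A : finite_automaton B) : set (infinite_word B) :=
  [set w | exists2 q : nat -> state A, infinite_path w q & successful q].

Definition buchi_recognizable (L : set (infinite_word B)) : Prop :=
  exists A : finite_automaton B, recognized A = L.

End Buchi.

Section Numbers.
Context {R : realType}.

Definition zero_words (beta : R) (M : nat) : set (infinite_word (digit M)) :=
  [set w : infinite_word (digit M) |
    series (fun i => (w i : int)%:~R * beta ^- i.+1) @ \oo --> (0 : R)].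

Definition minimal_polynomial (x : R) (p : {poly rat}) : Prop :=
  [/\ p \is monic, irreducible_poly p & root (map_poly ratr p) x].

Definition galois_conjugate (x : R) (z : R[i]) : Prop :=
  exists2 p : {poly rat},
    minimal_polynomial x p & root (map_poly ratr p) z.

Definition pisot (x : R) : Prop :=
  [/\ 1 < x, integralOver (intr : int -> R) x &
      forall z : R[i], galois_conjugate x z -> z != x%:C%C -> `|z| < 1].

End Numbers.

Arguments zero_words {R} beta M _.

(* Main.v *)
Require Import Defs.
From mathcomp Require Import all_boot all_order all_algebra.
From mathcomp Require Import all_classical all_reals all_analysis.
From mathcomp Require Import complex ring lra zify.

(** (3) => (1): along a word of value 0 the partial sums p_n(beta), and their
    conjugates, are bounded because all other conjugates lie in the open unit disc;
    so the residues of p_n modulo the minimal polynomial form a finite set, which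
    is the set of states of an automaton.

    (2) => (3): a state of the automaton determines the value of the prefix read, so
    the set X of remainders in [-1, 1] reachable from 0 by x |-> beta x + z,
    |z| <= M, is finite; this makes beta an algebraic integer.  Let alpha <> beta be
    a conjugate with |alpha| >= 1, and write sigma for the conjugation.  Unless
    beta is a root of X^(n+1) - M X^n - ... - M X - a with a <= M (and then it is
    Pisot), there is v in (0, 1) with v, v - 1 in X and sigma v <> v.  Rotate
    [0, 1) by v: a point rho and its image rho' differ by v or v - 1.  Expanding
    both in base beta, T^n rho' - T^n rho stays in X, and since the rotation
    preserves length, the mean over rho of sigma (T^n rho' - T^n rho) is exactly
    alpha^n (sigma v - v).  But the pairs (rho, rho') evolve according to a finite
    Markov chain, so alpha is an eigenvalue of a stochastic matrix; as
    |alpha| >= 1, it is a root of unity, and then so is beta: a contradiction. *)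

Set Implicit Arguments.
Unset Strict Implicit.
Unset Printing Implicit Defensive.

Import Order.TTheory GRing.Theory Num.Theory.
Import numFieldNormedType.Exports.

Local Open Scope complex_scope.
Local Open Scope classical_set_scope.
Local Open Scope ring_scope.

(** * Stochastic matrices *)

Lemma pigeonhole_seq (T : eqType) (s : seq T) (g : nat -> T) :
  (forall k, g k \in s) -> exists i j, (i < j)%N /\ g i = g j.
Proof.
move=> gs; have : ~~ uniq (mkseq g (size s).+1).
  apply/negP => gu; suff: ((size s).+1 <= size s)%N by rewrite ltnn.
  rewrite -{1}(size_mkseq g (size s).+1); apply: uniq_leq_size gu _.
  by move=> x /mapP[k _ ->]; exact: gs.
case/(uniqPn (g 0%N)) => i [j [ij]]; rewrite size_mkseq => js.
rewrite !nth_mkseq//; last exact: ltn_trans js.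
by move=> e; exists i, j.
Qed.

(** By linearity the hypothesis passes from powers to polynomials: u p(K) v = k p(a).
    Cayley-Hamilton, with p the characteristic polynomial, then gives p(a) = 0. *)
Lemma eigenvalue_of_moments (F : fieldType) n (K : 'M[F]_n.+1)
    (u : 'rV[F]_n.+1) (v : 'cV[F]_n.+1) (k a : F) : k != 0 ->
  (forall m, (u *m K ^+ m *m v) 0 0 = k * a ^+ m) -> eigenvalue K a.
Proof.
move=> k0 H; rewrite eigenvalue_root_char; apply/rootP.
(* The extra factor [K ^+ m] absorbs the multiplications by X in the induction on p. *)
have E p : forall m, (u *m (horner_mx K p * K ^+ m) *m v) 0 0 = k * p.[a] * a ^+ m.
  elim/poly_ind: p => [|p c IH] m.
    by rewrite rmorph0 mul0r mulmx0 mul0mx mxE horner0 mulr0 mul0r.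
  rewrite rmorphD rmorphM/= horner_mx_X horner_mx_C mulrDl mulmxDr mulmxDl mxE.
  rewrite -mulrA -exprS IH hornerD hornerMX hornerC -[c%:M * _]/(c%:M *m _) mul_scalar_mx -scalemxAr -scalemxAl mxE H exprS; ring.
have := E (char_poly K) 0%N.
rewrite Cayley_Hamilton mul0r mulmx0 mul0mx mxE mulr1 => /esym/eqP.
by rewrite mulf_eq0 (negbTE k0) => /eqP.
Qed.

(** At a coordinate i where an eigenvector w has maximal modulus, a w_i is a weighted mean of the
    w_j. As |a| >= 1, equality holds in the triangle inequality, so some w_j equals a w_i and is
    again maximal. Iterating, two powers of a must meet at the same coordinate. *)
Lemma stochastic_eigenvalue (C : numClosedFieldType) n (K : 'M[C]_n) (a : C) :
    (forall i j, 0 <= K i j) -> (forall i, \sum_j K j i = 1) ->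
    eigenvalue K a -> 1 <= `|a| ->
  exists2 m, (0 < m)%N & a ^+ m = 1.
Proof.
move=> K0 K1 /eigenvalueP[w wK w0] a1.
have wE i : \sum_j w 0 j * K j i = a * w 0 i.
  by move/matrixP/(_ 0 i) : wK; rewrite !mxE.
have [i0 wi0] : exists i0, w 0 i0 != 0.
  apply/existsP; apply: contraNT w0; rewrite negb_exists => /forallP h.
  by apply/eqP/rowP => j; rewrite mxE; apply/eqP/negPn/h.
have [im wim wmax] : exists2 i, w 0 i != 0 & forall j, `|w 0 j| <= `|w 0 i|.
  case: (@real_arg_maxP C 'I_n i0 xpredT (fun i => `|w 0 i|) isT) => [i _|i _ h].
    exact: normr_real.
  exists i => [|j]; last exact: h.
  by rewrite -normr_gt0; apply: lt_le_trans (h i0 isT); rewrite normr_gt0.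
have a0 : a != 0 by rewrite -normr_gt0; apply: lt_le_trans a1.
have next i : `|w 0 i| = `|w 0 im| -> exists j, w 0 j = a * w 0 i.
  move=> wi; have aw0 : a * w 0 i != 0 by rewrite mulf_neq0// -normr_gt0 wi normr_gt0.
  have H j : true -> `|w 0 j * K j i / (a * w 0 i)| <= K j i.
    move=> _; rewrite !normrM (ger0_norm (K0 _ _)) normrV ?unitfE// normrM mulrAC.
    apply: ler_piMl => //; rewrite ler_pdivrMr ?mul1r -?normrM ?normr_gt0//.
    by rewrite normrM (le_trans (wmax j))// -wi ler_peMl.
  have E := normC_sum_upper H.
  rewrite -mulr_suml wE divff// K1 in E.
  have [j Kj] : exists j, K j i != 0.
    apply/existsP; apply: contraT; rewrite negb_exists => /forallP h.
    have := K1 i; rewrite big1 => [/eqP|j _]; first by rewrite eq_sym oner_eq0.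
    exact/eqP/negPn/h.
  exists j; have := E erefl j isT; rewrite mulrAC => /(canRL (mulfK Kj)).
  by rewrite divff// => /(canRL (divfK aw0)); rewrite mul1r.
have pow k : exists i, w 0 i = a ^+ k * w 0 im /\ `|w 0 i| = `|w 0 im|.
  elim: k => [|k [i [wi wi']]]; first by exists im; rewrite mul1r.
  have [j wj] := next i wi'; exists j; rewrite wj exprS -mulrA -wi; split=> //.
  by apply/le_anti; rewrite -{1}wj wmax/= normrM wi' ler_peMl.
have [g gP] := boolp.choice pow.
have [k [l [kl gkl]]] := pigeonhole_seq (s := enum 'I_n) (g := g) (fun k => mem_enum _ _).
exists (l - k)%N; first by rewrite subn_gt0.
have [e1 _] := gP k; have [e2 _] := gP l; rewrite -gkl e1 in e2.
move/(mulIf wim): e2; rewrite -{1}(subnK (ltnW kl)) exprD -{1}[a ^+ k]mul1r.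
by move/(mulIf (expf_neq0 _ a0)).
Qed.

(** * Overlapping expansions *)

Section Seg.
Context {R : realFieldType} {V : zmodType}.
Implicit Types (phi : R -> V) (lo hi : R).

(** The integral over [lo, hi] of a function with primitive phi; empty intervals count for 0, so
    sums can run over all pairs of digits. *)
Definition seg phi lo hi := if lo < hi then phi hi - phi lo else 0.

Lemma segE phi lo hi : lo <= hi -> seg phi lo hi = phi hi - phi lo.
Proof.
by rewrite /seg le_eqVlt => /predU1P[->|->]//; rewrite ltxx subrr.
Qed.

Lemma seg0 phi lo hi : hi <= lo -> seg phi lo hi = 0.
Proof. by rewrite /seg ltNge => ->. Qed.

Lemma seg_split phi lo hi (u : nat -> R) K :
    (forall k, u k <= u k.+1) -> u 0%N <= lo -> hi <= u K ->
  \sum_(k < K) seg phi (Num.max lo (u k)) (Num.min hi (u k.+1)) = seg phi lo hi.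
Proof.
move=> uS u0 uK.
suff E j : \sum_(k < j) seg phi (Num.max lo (u k)) (Num.min hi (u k.+1)) =
    seg phi lo (Num.min hi (u j)).
  by rewrite E (min_idPl uK).
elim: j => [|j IH]; first by rewrite big_ord0 seg0// ge_min u0 orbT.
rewrite big_ord_recr/= {}IH; have := uS j.
move: (u j) (u j.+1) => x y xy.
have [hx|xh] := leP hi x.
  by rewrite (min_idPl (le_trans hx xy)) [X in _ + X]seg0 ?addr0// le_max hx orbT.
have xm : x <= Num.min hi y by rewrite le_min xy ltW.
have [lx|xl] := leP lo x; last by rewrite seg0 ?add0r// ltW.
by rewrite !segE ?(le_trans lx)// addrC subrKA.
Qed.
End Seg.

Section Overlaps.
Context {R : rcfType} (b : R) (a : R[i]) (M : nat).
Hypotheses (b0 : 0 < b) (bM : b <= M.+1%:R).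
Implicit Types (l r x : R) (y : R[i]).

(** The position of x relative to the cell [d / b, (d + 1) / b] of the points with digit d, rescaled
    to [0, 1] and truncated. *)
Definition clamp d x : R := Num.min (Num.max (b * x - d%:R) 0) 1.

(* For rho in [l, r] and rho' = rho + x, both in [0, 1], the points rho such that
   b rho - d and b rho' - d' lie in [0, 1] form an interval; it is mapped by
   rho |-> b rho - d onto [ovl l x d d', ovr r x d d'], and the difference of the
   two images is b x + d - d'. *)
Definition ovl l x (d d' : nat) : R :=
  Num.max (Num.max (b * l - d%:R) 0) (- (b * x + d%:R - d'%:R)).
Definition ovr r x (d d' : nat) : R :=
  Num.min (Num.min (b * r - d%:R) 1) (1 - (b * x + d%:R - d'%:R)).

Definition overlap l r x :=
  [&& l < r, 0 <= l, r <= 1, 0 <= l + x & r + x <= 1].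

Lemma overlap_child l r x d d' : ovl l x d d' < ovr r x d d' ->
  overlap (ovl l x d d') (ovr r x d d') (b * x + d%:R - d'%:R).
Proof.
rewrite /overlap => -> /=; rewrite /ovl /ovr; set e := (_ + _ - _).
apply/and4P; split.
- by rewrite !le_max lexx orbT.
- by rewrite !ge_min lexx orbT.
- by rewrite -lerBlDr sub0r le_max lexx orbT.
- by rewrite -lerBrDr ge_min lexx orbT.
Qed.

Lemma seg_clamp (V : zmodType) (phi : R -> V) l r d : l <= r ->
  seg phi (Num.max (b * l - d%:R) 0) (Num.min (b * r - d%:R) 1) =
  phi (clamp d r) - phi (clamp d l).
Proof.
move=> lr; rewrite /clamp; have : b * l - d%:R <= b * r - d%:R.
  by rewrite lerD2r ler_pM2l.
move: (b * l - _) (b * r - _) => u v uv.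
have [u1|u1] := leP u 1; last first.
  rewrite (max_idPl _); last lra.
  rewrite (max_idPl _); last lra.
  by rewrite !(min_idPr _) ?subrr ?seg0//; lra.
have [v0|v0] := leP v 0.
  rewrite (max_idPr (le_trans uv v0)) (min_idPl _); last lra.
  by rewrite seg0// subrr.
rewrite [Num.min (Num.max u _) _](min_idPl _) ?ge_max ?u1 ?ler01//.
by rewrite segE// le_min !ge_max uv u1 ler01 ltW.
Qed.

Section Fixed.
Context (l r x : R).
Hypothesis ov : overlap l r x.

Lemma seg_split_right (V : zmodType) (phi : R -> V) d :
  \sum_(d' < M.+1) seg phi (ovl l x d d') (ovr r x d d') =
  phi (clamp d r) - phi (clamp d l).
Proof.
case/and5P: ov => lr l0 r1 lx rx; rewrite -seg_clamp ?ltW//.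
(* In the coordinate z = b rho - d, these are the points where b rho' - d' = z + (b x + d - d')
   vanishes, that is, where the digit of rho' changes. *)
rewrite -(@seg_split _ _ _ _ _ (fun d' => d'%:R - (b * x + d%:R)) M.+1).
- by apply: eq_bigr => d' _; rewrite /ovl /ovr; congr seg; congr (_ _ _); rewrite ?mulrSr; ring.
- by move=> k; rewrite lerD2r ler_nat.
- rewrite le_max sub0r; apply/orP; left.
  by have := mulr_ge0 (ltW b0) lx; rewrite mulrDr; lra.
- rewrite ge_min; apply/orP; left.
  have h := ler_wpM2l (ltW b0) rx; rewrite mulrDr mulr1 in h.
  by move: h bM; move: (M.+1%:R : R) => m h h'; lra.
Qed.

Lemma seg_split_left (V : zmodType) (phi : R -> V) d' :
  \sum_(d < M.+1) seg (fun z => phi (z + (b * x + d%:R - d'%:R)))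
      (ovl l x d d') (ovr r x d d') =
  phi (clamp d' (r + x)) - phi (clamp d' (l + x)).
Proof.
case/and5P: ov => lr l0 r1 lx rx; rewrite -seg_clamp ?lerD2r ?ltW//.
rewrite -(@seg_split _ _ _ _ _ (fun d => d%:R + (b * x - d'%:R)) M.+1).
- apply: eq_bigr => d _; set e := b * x + d%:R - d'%:R.
  have -> : Num.max (Num.max (b * (l + x) - d'%:R) 0) (d%:R + (b * x - d'%:R)) =
            ovl l x d d' + e.
    rewrite /ovl -/e !addr_maxl maxAC addNr add0r; congr (Num.max (Num.max _ _) _).
    + by rewrite /e; ring.
    + by rewrite /e; ring.
  have -> : Num.min (Num.min (b * (r + x) - d'%:R) 1) (d.+1%:R + (b * x - d'%:R)) =
            ovr r x d d' + e.
    rewrite /ovr -/e !addr_minl minAC subrK; congr (Num.min (Num.min _ _) _).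
    + by rewrite /e; ring.
    + by rewrite /e mulrSr; ring.
  by rewrite /seg ltrD2r.
- by move=> k; rewrite lerD2r ler_nat.
- rewrite le_max add0r; apply/orP; left.
  by have := mulr_ge0 (ltW b0) l0; rewrite mulrDr; lra.
- rewrite ge_min; apply/orP; left.
  have h := ler_wpM2l (ltW b0) r1; rewrite mulr1 in h.
  by rewrite mulrDr; move: h bM; move: (M.+1%:R : R) => m h h'; lra.
Qed.

Lemma sum_clamp : \sum_(d < M.+1) (clamp d r - clamp d l) = b * (r - l).
Proof.
case/and5P: (ov) => lr l0 r1 lx rx.
under eq_bigr => d _ do rewrite -(seg_clamp id d (ltW lr)).
rewrite mulrBr -[RHS](segE id) ?ler_pM2l// ?ltW//.
rewrite -(@seg_split _ _ _ _ _ (fun d => d%:R) M.+1).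
- apply: eq_bigr => d _.
  have -> : Num.max (b * l) d%:R = Num.max (b * l - d%:R) 0 + d%:R.
    by rewrite addr_maxl subrK add0r.
  have -> : Num.min (b * r) d.+1%:R = Num.min (b * r - d%:R) 1 + d%:R.
    by rewrite addr_minl subrK -mulrS.
  by rewrite /seg ltrD2r /= opprD addrACA subrr addr0.
- by move=> k; rewrite ler_nat.
- by rewrite mulr_ge0// ltW.
- by rewrite (le_trans _ bM)// -{2}[b]mulr1 ler_pM2l.
Qed.

Lemma seg_split_len :
  \sum_(d < M.+1) \sum_(d' < M.+1) seg id (ovl l x d d') (ovr r x d d') = b * (r - l).
Proof. by rewrite -sum_clamp; apply: eq_bigr => d _; rewrite seg_split_right. Qed.

End Fixed.

(* With T the expansion map rho |-> b rho - d and y the conjugate of x, this is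
   the integral over rho in [l, r] of the conjugate of T^n (rho + x) - T^n rho. *)
Fixpoint mean n l r x y : R[i] :=
  if n is n.+1 then
    b^-1%:C * \sum_(d < M.+1) \sum_(d' < M.+1)
      if ovl l x d d' < ovr r x d d' then
        mean n (ovl l x d d') (ovr r x d d')
          (b * x + d%:R - d'%:R) (a * y + d%:R - d'%:R)
      else 0
  else (r - l)%:C * y.

(* Primitive of rho |-> \sum_(i < n) d_i(rho) a^(n-1-i), with d_i(rho) the
   successive digits of rho. *)
Fixpoint prim n x : R[i] :=
  if n is n.+1 then
    b^-1%:C * \sum_(d < M.+1) (a ^+ n * d%:R * (clamp d x)%:C + prim n (clamp d x))
  else 0.

(** The conjugate of T^n rho' - T^n rho is a^n y plus a digit sum for rho minus the same sum for
    rho'; each digit sum integrates to a difference of values of [prim n]. In the induction the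
    terms in rho are summed over d' first, those in rho' over d first. *)
Lemma meanE n l r x y : overlap l r x ->
  mean n l r x y = a ^+ n * (r - l)%:C * y
     + (prim n r - prim n l) - (prim n (r + x) - prim n (l + x)).
Proof.
elim: n l r x y => [|n IH] l r x y ov.
  by rewrite /= mul1r !subr0 addr0.
pose H d z := a ^+ n * d%:R * z%:C + prim n z.
have -> : mean n.+1 l r x y = b^-1%:C * \sum_(d < M.+1) \sum_(d' < M.+1)
   (a ^+ n.+1 * y * (seg id (ovl l x d d') (ovr r x d d'))%:C
    + seg (H d) (ovl l x d d') (ovr r x d d')
    - seg (fun z => H d' (z + (b * x + d%:R - d'%:R))) (ovl l x d d') (ovr r x d d')).
  rewrite /=; congr (_ * _); apply: eq_bigr => d _; apply: eq_bigr => d' _.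
  rewrite /seg; case: ifPn => [lt|_]; last by rewrite mulr0 subr0 addr0.
  rewrite IH; last exact: overlap_child.
  by rewrite /H exprS !rmorphD/= !rmorphN/=; ring.
under eq_bigr => d _ do rewrite sumrB big_split/= -mulr_sumr -rmorph_sum
  (seg_split_right ov id) (seg_split_right ov (H d)).
rewrite sumrB big_split/= -mulr_sumr -rmorph_sum (sum_clamp ov) exchange_big/=.
under [X in _ - X]eq_bigr => d' _ do rewrite (seg_split_left ov (H d')).
rewrite !sumrB rmorphM/=.
have bb : b^-1%:C * b%:C = 1 :> R[i] by rewrite -rmorphM/= mulVf ?rmorph1// gt_eqF.
rewrite /H exprS; ring: bb.
Qed.

End Overlaps.

(** * The Markov chain of overlapping pairs *)

Section OverlapGraph.
Context {R : rcfType} (b : R) (a : R[i]) (M : nat).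
Hypotheses (b0 : 0 < b) (bM : b <= M.+1%:R).

(** A state ((l, r), (x, y)): rho runs over [l, r], rho' = rho + x, and y is the conjugate of x. *)
Definition ovstate := (R * R * (R * R[i]))%type.
Implicit Types s : ovstate.

Definition ovlen s := s.1.2 - s.1.1.
Definition child s (d d' : nat) : ovstate :=
  ((ovl b s.1.1 s.2.1 d d', ovr b s.1.2 s.2.1 d d'),
   (b * s.2.1 + d%:R - d'%:R, a * s.2.2 + d%:R - d'%:R)).
Definition ovmean n s := mean b a M n s.1.1 s.1.2 s.2.1 s.2.2.

Variables (L : seq ovstate) (s0 : ovstate).
Hypotheses (Luniq : uniq L) (Lov : forall s, s \in L -> overlap s.1.1 s.1.2 s.2.1).
Hypothesis Lchild : forall s (d d' : 'I_M.+1), s \in L ->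
  0 < ovlen (child s d d') -> child s d d' \in L.
Hypothesis Ls0 : s0 \in L.

Let N := (size L).-1.
Let sizeL : size L = N.+1.
Proof. by rewrite /N; case: L Ls0. Qed.

Let S (i : 'I_N.+1) := nth s0 L i.
Let SL i : S i \in L.
Proof. by rewrite mem_nth// sizeL. Qed.
Let len_gt0 s : s \in L -> 0 < ovlen s.
Proof. by move=> /Lov/andP[]; rewrite subr_gt0. Qed.

Let sum_state (F : ovstate -> R[i]) s : s \in L ->
  \sum_j (if s == S j then F (S j) else 0) = F s.
Proof.
move=> sL; have iL : (index s L < N.+1)%N by rewrite -sizeL index_mem.
rewrite -big_mkcond/= (big_pred1 (Ordinal iL)) => [|j]/=.
  by rewrite /S/= nth_index.
rewrite -val_eqE /S /=; apply/eqP/eqP => [e|->]; last by rewrite nth_index.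
by rewrite e index_uniq// sizeL.
Qed.

(** The probability that a uniform rho in the interval of s, together with rho', has the digits d
    and d'; the factor b undoes the expansion of the child. *)
Definition weight s d d' : R[i] := (ovlen (child s d d') / (b * ovlen s))%:C.

(** Column i holds the transition probabilities out of [S i]; different pairs of digits may lead to
    the same state. *)
Let K : 'M[R[i]]_N.+1 := \matrix_(j, i) \sum_(d < M.+1) \sum_(d' < M.+1)
  if (0 < ovlen (child (S i) d d')) && (child (S i) d d' == S j)
  then weight (S i) d d' else 0.

Let sum_K (F : ovstate -> R[i]) i :
  \sum_j F (S j) * K j i = \sum_(d < M.+1) \sum_(d' < M.+1)
  if 0 < ovlen (child (S i) d d') then F (child (S i) d d') * weight (S i) d d' else 0.
Proof.
under eq_bigr => j _ do rewrite mxE mulr_sumr.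
rewrite exchange_big; apply: eq_bigr => d _ /=.
under eq_bigr => j _ do rewrite mulr_sumr.
rewrite exchange_big; apply: eq_bigr => d' _ /=.
case: ifPn => [lt0|_]; last by rewrite big1// => j _; rewrite mulr0.
rewrite -(sum_state (fun s => F s * _)) ?Lchild//; apply: eq_bigr => j _ /=.
by case: ifP => _; rewrite ?mulr0.
Qed.

Let u : 'rV[R[i]]_N.+1 := \row_i (S i).2.2.

Let rowK m i : (u *m K ^+ m) 0 i = ovmean m (S i) / (ovlen (S i))%:C.
Proof.
have lenC s : s \in L -> (ovlen s)%:C != 0 :> R[i].
  by move=> sL; rewrite (fmorph_eq0 (real_complex R)) gt_eqF// len_gt0.
elim: m i => [|m IH] i.
  by rewrite mulmx1 mxE /ovmean/= mulrAC divff ?mul1r ?lenC.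
rewrite exprSr mulmxA mxE; under eq_bigr => j _ do rewrite IH.
rewrite (sum_K (fun s => ovmean m s / (ovlen s)%:C)) /ovmean/=.
rewrite mulrAC mulr_sumr; apply: eq_bigr => d _.
rewrite mulr_sumr; apply: eq_bigr => d' _.
rewrite {1}/ovlen subr_gt0; case: ifPn => lt; rewrite ?mulr0//=.
have cL : child (S i) d d' \in L by rewrite Lchild// subr_gt0.
rewrite /weight rmorphM !fmorphV rmorphM/=.
have := lenC _ cL; have := lenC _ (SL i).
have : b%:C != 0 :> R[i] by rewrite (fmorph_eq0 (real_complex R)) gt_eqF.
move: (ovlen _)%:C (ovlen _)%:C => x y z0 x0 y0.
by field; rewrite x0 y0 z0.
Qed.

Let K_ge0 j i : 0 <= K j i.
Proof.
rewrite mxE; apply: sumr_ge0 => d _; apply: sumr_ge0 => d' _.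
case: ifP => // /andP[lt _]; rewrite ler0c.
by rewrite divr_ge0 ?mulr_ge0 ?ltW// len_gt0.
Qed.

Let K_sum i : \sum_j K j i = 1.
Proof.
under eq_bigr => j _ do rewrite -[K _ _]mul1r.
rewrite (sum_K (fun=> 1)).
have bl : b * ovlen (S i) != 0 by rewrite mulf_neq0 ?gt_eqF ?len_gt0.
have E1 : 1 = ((\sum_(d < M.+1) \sum_(d' < M.+1) seg id
    (ovl b (S i).1.1 (S i).2.1 d d') (ovr b (S i).1.2 (S i).2.1 d d'))
    / (b * ovlen (S i)))%:C :> R[i].
  by rewrite (seg_split_len b0 bM (Lov (SL i))) divff// rmorph1.
rewrite [RHS]E1 mulr_suml rmorph_sum; apply: eq_bigr => d _ /=.
rewrite mulr_suml rmorph_sum; apply: eq_bigr => d' _ /=.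
rewrite {1}/ovlen subr_gt0 /seg; case: ifP => _; last by rewrite mul0r rmorph0.
by rewrite mul1r.
Qed.

(* Rotation by v on [0, 1) is x |-> x + v on [0, 1 - v) and x |-> x + v - 1 on
   [1 - v, 1).  It preserves length, so the terms [prim] cancel. *)
Lemma overlap_root_of_unity v y : 1 <= `|a| -> y != v%:C ->
    (0, 1 - v, (v, y)) \in L -> (1 - v, 1, (v - 1, y - 1)) \in L ->
  exists2 m, (0 < m)%N & a ^+ m = 1.
Proof.
move=> a1 yv; set s1 := (0, _, _); set s2 := (1 - v, _, _) => s1L s2L.
apply: (stochastic_eigenvalue K_ge0 K_sum) => //.
have i1L : (index s1 L < N.+1)%N by rewrite -sizeL index_mem.
have i2L : (index s2 L < N.+1)%N by rewrite -sizeL index_mem.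
have S1 : S (Ordinal i1L) = s1 by rewrite /S/= nth_index.
have S2 : S (Ordinal i2L) = s2 by rewrite /S/= nth_index.
(* The two pieces of the rotation weighted by their lengths, so that u K^m w is the mean over all of
   [0, 1]. *)
pose w : 'cV[R[i]]_N.+1 := (1 - v)%:C *: delta_mx (Ordinal i1L) 0
                       + v%:C *: delta_mx (Ordinal i2L) 0.
apply: (@eigenvalue_of_moments _ _ K u w (y - v%:C)); first by rewrite subr_eq0.
move=> m; have [ov1 ov2] := (Lov s1L, Lov s2L).
have v1 : (1 - v)%:C != 0 :> R[i].
  rewrite (fmorph_eq0 (real_complex R)) gt_eqF//.
  by have := len_gt0 s1L; rewrite /ovlen subr0.
have v0 : v%:C != 0 :> R[i].
  rewrite (fmorph_eq0 (real_complex R)) gt_eqF//.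
  by have := len_gt0 s2L; rewrite /ovlen/= subKr.
have colK c i : (c *: col i (u *m K ^+ m)) 0 0 = c * (ovmean m (S i) / (ovlen (S i))%:C).
  by rewrite mxE mxE rowK.
rewrite mulmxDr -!scalemxAr -!colE mxE !colK S1 S2 /ovlen/= subr0 subKr.
rewrite ![_%:C * (_ / _)]mulrC !divfK// /ovmean !meanE//= subr0 subKr.
rewrite add0r subrK [1 + (v - 1)]addrC subrK.
rewrite [1 - v + (v - 1)]addrA subrK subrr.
rewrite !rmorphB/= rmorph1; ring.
Qed.

End OverlapGraph.

(** * Words and reachable remainders *)

Notation eval x p := (map_poly intr p).[x].

Section Eval.
Context {K : comNzRingType}.
Implicit Types (x : K) (p : {poly int}) (z : int).

Lemma evalM x p q : eval x (p * q) = eval x p * eval x q.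
Proof. by rewrite rmorphM hornerM. Qed.

Lemma evalB x p q : eval x (p - q) = eval x p - eval x q.
Proof. by rewrite rmorphB hornerD hornerN. Qed.

Lemma evalD x p q : eval x (p + q) = eval x p + eval x q.
Proof. by rewrite rmorphD hornerD. Qed.

Lemma evalC x z : eval x z%:P = z%:~R.
Proof. by rewrite map_polyC hornerC. Qed.

Lemma evalXn x n : eval x 'X^n = x ^+ n.
Proof. by rewrite map_polyXn hornerXn. Qed.

Lemma evalS x p z : eval x (p * 'X + z%:P) = x * eval x p + z%:~R.
Proof. by rewrite evalD evalM evalC map_polyX hornerX mulrC. Qed.
End Eval.

Section Words.
Implicit Types (w : nat -> int).

(** Its value at b is b^n times the n-th partial sum of the series. It is kept formal because it is
    also evaluated at conjugates. *)
Fixpoint pol w n : {poly int} :=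
  if n is n.+1 then pol w n * 'X + (w n)%:P else 0.

Lemma pol_add w n k : pol w (n + k) = pol w n * 'X^k + pol (fun i => w (n + i)%N) k.
Proof.
elim: k => [|k IH]; first by rewrite addn0 mulr1 addr0.
by rewrite addnS /= IH exprSr mulrDl !mulrA addrA.
Qed.

Lemma eq_pol w w' n : (forall i, (i < n)%N -> w i = w' i) -> pol w n = pol w' n.
Proof. by elim: n => //= n IH e; rewrite e// IH// => i /ltnW; exact: e. Qed.
End Words.

Section ZeroWords.
Context {R : realType} (b : R) (M : nat).
Hypothesis b1 : 1 < b.
Let b0 : 0 < b. Proof. exact: lt_trans b1. Qed.

Lemma exp_unbounded (x y : R) : 0 < y -> exists k, x < y * b ^+ k.
Proof.
move=> y0; have b10 : 0 < b - 1 by rewrite subr_gt0.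
have bernoulli k : 1 + k%:R * (b - 1) <= b ^+ k.
  elim: k => [|k IH]; first by rewrite mul0r addr0.
  have k0 : 0 <= k%:R * (b - 1) by rewrite mulr_ge0// ltW.
  rewrite exprS; have := ler_wpM2l (ltW b0) IH; rewrite mulrSr; nra.
have xP := archi_boundP (divr_ge0 (normr_ge0 x) (ltW (mulr_gt0 y0 b10))).
exists (Num.bound (`|x| / (y * (b - 1)))); set k := Num.bound _ in xP *.
rewrite ltr_pdivrMr ?mulr_gt0// in xP.
apply: le_lt_trans (ler_norm _) (lt_le_trans xP _).
have := ler_wpM2l (ltW y0) (bernoulli k); nra.
Qed.

Lemma series_pol (w : nat -> int) n :
  series (fun i => (w i)%:~R * b ^- i.+1) n = eval b (pol w n) * b ^- n.
Proof.
elim: n => [|n IH]; first by rewrite /series/= big_geq// rmorph0 horner0 mul0r.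
rewrite seriesSr IH evalS mulrDl; congr (_ + _).
by rewrite exprS invfM mulrACA divff ?gt_eqF// mul1r.
Qed.

Lemma bounded_zero_words (w : nat -> digit M) (K : R) :
  (forall n, `|eval b (pol (fun i => w i : int) n)| <= K) -> zero_words b M w.
Proof.
move=> H; rewrite /zero_words/=.
have -> : series (fun i => (w i : int)%:~R * b ^- i.+1) =
   (fun n => eval b (pol (fun i => w i : int) n) * b ^- n).
  by apply/funext => n; rewrite (series_pol (fun i => w i : int)).
have G : geometric K b^-1 @ \oo --> (0 : R).
  by apply: cvg_geometric; rewrite ger0_norm ?invf_lt1// invr_ge0 ltW.
apply: (@squeeze_cvgr _ _ _ _ (fun n => - geometric K b^-1 n) (geometric K b^-1)) => //.
- near=> n; rewrite -ler_norml /= normrM ler_pM//.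
  by rewrite ger0_norm ?exprVn// invr_ge0 exprn_ge0// ltW.
- by rewrite -oppr0; apply: cvgN.
Unshelve. all: by end_near. Qed.

(** M / (b - 1) is the fixed point of x |-> b x - M: once a remainder exceeds it in modulus, the
    excess is multiplied by at least b at each step, and the partial sums stay away from 0. *)
Lemma zero_words_bounded (w : nat -> digit M) n : zero_words b M w ->
  `|eval b (pol (fun i => w i : int) n)| <= M%:R / (b - 1).
Proof.
pose s k := eval b (pol (fun i => w i : int) k); rewrite -/(s n).
move=> H; have {H} : (fun k => s k * b ^- k) @ \oo --> (0 : R).
  apply: cvg_trans H; apply: near_eq_cvg; near=> k.
  by rewrite (series_pol (fun i => w i : int)).
move=> /cvgrPdist_lt H; rewrite leNgt; apply/negP; set c := _ / _ => cs.
have b10 : 0 < b - 1 by rewrite subr_gt0.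
have cE : b * c = c + M%:R by rewrite /c; field; rewrite gt_eqF.
have grow k : (`|s n| - c) * b ^+ k <= `|s (n + k)%N| - c.
  elim: k => [|k IH]; first by rewrite addn0 mulr1.
  have wM : `|(w (n + k)%N : int)%:~R| <= M%:R :> R.
    by rewrite -intr_norm -[M%:R]/(M%:Z%:~R) ler_int ler_norml; case: (w _).
  have -> : s (n + k.+1)%N = b * s (n + k)%N + (w (n + k)%N : int)%:~R.
    by rewrite /s addnS/= evalS.
  have := lerB_normD (b * s (n + k)%N) ((w (n + k)%N : int)%:~R).
  rewrite normrM (gtr0_norm b0) exprS mulrCA.
  by have := ler_wpM2l (ltW b0) IH; rewrite mulrBr cE; lra.
have d0 : 0 < (`|s n| - c) * b ^- n by rewrite divr_gt0 ?subr_gt0 ?exprn_gt0.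
have [N _ HN] := H _ d0; have := HN (n + N)%N (leq_addl _ _).
rewrite /= sub0r normrN normrM normfV (ger0_norm (exprn_ge0 _ (ltW b0))).
rewrite ltr_pdivrMr ?exprn_gt0// exprD mulrA divfK ?expf_neq0 ?gt_eqF// ltNge => /negP; apply.
apply: le_trans (grow N) _; rewrite gerBl divr_ge0// ltW.
Unshelve. all: by end_near. Qed.

(** Reading k common letters multiplies the difference of the two remainders by b^k, yet both
    remainders stay bounded. *)
Lemma zero_words_tail (w w' : nat -> digit M) n n' :
    zero_words b M w -> zero_words b M w' -> (forall k, w (n + k)%N = w' (n' + k)%N) ->
  eval b (pol (fun i => w i : int) n) = eval b (pol (fun i => w' i : int) n').
Proof.
move=> z z' e; apply/eqP; rewrite -subr_eq0 -normr_le0 leNgt; apply/negP => d0.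
have [k] := exp_unbounded (M%:R / (b - 1) + M%:R / (b - 1)) d0.
rewrite ltNge => /negP; apply.
have := zero_words_bounded (n + k) z; have := zero_words_bounded (n' + k) z'.
rewrite !pol_add; set q := pol _ k; have -> : pol (fun i => w (n + i)%N : int) k = q.
  by apply: eq_pol => i _; rewrite e.
rewrite !evalD !evalM !evalXn => h h'.
rewrite -(gtr0_norm (exprn_gt0 k b0)) -normrM mulrBl.
apply: le_trans (lerD h' h); apply: le_trans (ler_normB _ _).
by rewrite opprD addrACA subrr addr0.
Qed.

End ZeroWords.

Section Reach.
Context {R : realType} (b : R) (M : nat).

(** Remainders as formal polynomials, with all intermediate values in [-1, 1]. *)
Inductive reach : {poly int} -> Prop :=
| reach0 : reach 0
| reachS p (z : int) of reach p & - M%:Z <= z <= M%:Z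
    & `|eval b (p * 'X + z%:P)| <= 1 : reach (p * 'X + z%:P).

Lemma reach_le1 p : reach p -> `|eval b p| <= 1.
Proof. by case=> [|//]; rewrite rmorph0 horner0 normr0 ler01. Qed.

Hypotheses (b1 : 1 < b) (bM : b <= M.+1%:R).
Let b0 : 0 < b. Proof. exact: lt_trans b1. Qed.

(** Since |b x| <= M + 1, an extreme digit suffices when |b x| > M, and minus the floor of b x
    otherwise. *)
Lemma digit_exists (x : R) : `|x| <= 1 ->
  exists z : digit M, `|b * x + (z : int)%:~R| <= 1.
Proof.
move=> x1; have : `|b * x| <= M%:R + 1.
  by rewrite normrM (gtr0_norm b0) -mulrSr (le_trans _ bM)// ler_piMr// ltW.
move: (b * x) => y; rewrite ler_norml => /andP[yl yr].
have dM (z : int) : - M%:Z <= z <= M%:Z -> `|y + z%:~R| <= 1 ->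
    exists z : digit M, `|y + (z : int)%:~R| <= 1.
  by move=> zM h; exists (Digit zM).
have [My|yM] := ltP M%:R y.
  apply: (dM (- M%:Z)); first by lia.
  by rewrite mulrNz ler_norml; apply/andP; split; lra.
have [My'|yM'] := ltP y (- M%:R).
  apply: (dM M%:Z); first by lia.
  by rewrite ler_norml; apply/andP; split; rewrite -?[M%:Z%:~R]/(M%:R); lra.
have [fl fu] := (floor_le y, floorD1_gt y).
apply: (dM (- Num.floor y)).
  have : Num.floor y <= M%:Z by rewrite -(ler_int R); exact: le_trans fl yM.
  have : - M%:Z <= Num.floor y by rewrite floor_ge_int mulrNz.
  by move: (Num.floor y) => z; lia.
rewrite mulrNz ler_norml; move: fl fu; rewrite intrD; move: (_%:~R) => z.
by move=> fl fu; apply/andP; split; lra.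
Qed.

Lemma digit_extension p : `|eval b p| <= 1 ->
  exists w : nat -> digit M, forall k,
    `|eval b (p * 'X^k + pol (fun i => w i : int) k)| <= 1.
Proof.
move=> p1.
have [f fP] : exists f : R -> digit M,
    forall x, `|x| <= 1 -> `|b * x + (f x : int)%:~R| <= 1.
  suff H x : exists z : digit M, `|x| <= 1 -> `|b * x + (z : int)%:~R| <= 1.
    by have [f fP] := boolp.choice H; exists f.
  have [/digit_exists[z zP]|_] := leP `|x| 1; first by exists z.
  have [z _] : exists z : digit M, `|b * 0 + (z : int)%:~R| <= 1.
    by apply: digit_exists; rewrite normr0 ler01.
  by exists z.
pose s k := iter k (fun q => q * 'X + (f (eval b q) : int)%:P) p.
exists (fun k => f (eval b (s k))) => k.
have -> : p * 'X^k + pol (fun i => f (eval b (s i)) : int) k = s k.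
  elim: k => [|k IH]; first by rewrite mulr1 addr0.
  by rewrite /= exprSr mulrA addrA -mulrDl IH.
by elim: k => //= k IH; rewrite evalS; exact: fP.
Qed.

(** A prefix producing p is continued by digits that keep the remainders in [-1, 1]; bounded
    remainders mean value 0. *)
Lemma reach_word p : reach p -> exists2 w : nat -> digit M,
  zero_words b M w & exists n, pol (fun i => w i : int) n = p.
Proof.
move=> rp.
suff H : forall p, reach p -> forall w' : nat -> digit M, exists (w : nat -> digit M) n,
   [/\ pol (fun i => w i : int) n = p,
       forall k, (k <= n)%N -> `|eval b (pol (fun i => w i : int) k)| <= 1
     & forall k, w (n + k)%N = w' k].
  have [w' w'P] := digit_extension (reach_le1 rp).
  have [w [n [wn wle wtail]]] := H _ rp w'; exists w; last by exists n.
  apply: (@bounded_zero_words _ _ _ b1 _ 1) => k.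
  have [/wle//|/ltnW nk] := leqP k n.
  rewrite -(subnKC nk) pol_add wn.
  by have := w'P (k - n)%N; congr (`|eval b (_ + _)| <= 1); apply: eq_pol => i _; rewrite wtail.
move=> p'; elim=> [w'|q z rq IH zM qz w'].
  by exists w', 0%N; split=> // k; rewrite leqn0 => /eqP ->; rewrite rmorph0 horner0 normr0 ler01.
have [w [n [wn wle wt]]] := IH (fun k => if k is k.+1 then w' k else Digit zM).
have wnz : w n = Digit zM by have := wt 0%N; rewrite addn0.
exists w, n.+1; split=> [|k|k].
- by rewrite /= wn wnz.
- by rewrite leq_eqVlt ltnS => /predU1P[->|/wle//]; rewrite /= wn wnz.
- by rewrite addSnnS wt.
Qed.

(* Two accepted words passing through the same automaton state can be spliced, so
   the state determines the value of the prefix read so far. *)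
Lemma buchi_reach_finite : buchi_recognizable (zero_words b M) ->
  exists s : seq R, forall p, reach p -> eval b p \in s.
Proof.
move=> [A recA].
pose at_state q x := exists (w : nat -> digit M) (r : nat -> state A) n,
  [/\ infinite_path w r, successful r, r n = q & eval b (pol (fun i => w i : int) n) = x].
have zeroA (w : nat -> digit M) (r : nat -> state A) :
    infinite_path w r -> successful r -> zero_words b M w.
  by move=> pw sr; rewrite -recA; exists r.
have at_inj q x x' : at_state q x -> at_state q x' -> x = x'.
  move=> [w [r [n [pw sr rn <-]]]] [w' [r' [n' [pw' sr' rn' <-]]]].
  (* The prefix of w followed by the tail of w'; the spliced path is successful because visiting
     terminal states infinitely often depends only on the tail. *)
  pose w2 k := if (k < n)%N then w k else w' (n' + (k - n))%N.
  pose r2 k := if (k < n)%N then r k else r' (n' + (k - n))%N.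
  have r2n k : (k <= n)%N -> r2 k = r k.
    rewrite /r2 leq_eqVlt => /predU1P[->|->//].
    by rewrite ltnn subnn addn0 rn rn'.
  have pw2 : infinite_path w2 r2.
    move=> k; have [kn|nk] := ltnP k n.
      by rewrite !r2n// 1?ltnW// /w2 kn; exact: pw.
    rewrite /w2 /r2 ltnNge nk ltnNge (leq_trans nk)//= subSn// addnS; exact: pw'.
  have sr2 : successful r2.
    split; first by rewrite r2n//; case: sr.
    move=> m; case: sr' => _ /(_ (n' + m)%N)[k mk kT].
    have nk : (n' <= k)%N := leq_trans (leq_addr _ _) mk.
    exists (n + (k - n'))%N; first by rewrite (leq_trans _ (leq_addl _ _))// leq_subRL.
    by rewrite /r2 ltnNge leq_addr/= addKn subnKC.
  rewrite -(@eq_pol (fun i => w2 i : int)); last by move=> i; rewrite /w2 => ->.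
  apply: (zero_words_tail b1 (zeroA _ _ pw2 sr2) (zeroA _ _ pw' sr')) => k.
  by rewrite /w2 ltnNge leq_addr/= addKn.
pose f q := xget 0 [set x | at_state q x].
exists [seq f q | q <- enum (state A)] => p /reach_word[w wz [n wn]].
have [r pw sr] : recognized A w by rewrite recA.
apply/mapP; exists (r n); first by rewrite mem_enum.
have rw : at_state (r n) (eval b p) by exists w, r, n; rewrite wn.
rewrite /f; case: xgetP => [x _ ax|/(_ (eval b p))/(_ rw)//].
exact: at_inj rw ax.
Qed.

(** From 1 on, there are reachable monic polynomials of every degree. Two of different degrees agree
    at b, and their difference is monic. *)
Lemma reach_integral (s : seq R) : (0 < M)%N ->
  (forall p, reach p -> eval b p \in s) -> integralOver (intr : int -> R) b.
Proof.
move=> M0 sP.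
have H k : exists p, [/\ reach p, p \is monic & size p = k.+1].
  elim: k => [|k [p [rp mp sp]]].
    exists 1; rewrite monic1 size_poly1; split=> //.
    rewrite -[1]addr0 addrC -{1}(mul0r 'X) -polyC1.
    apply: reachS; [exact: reach0|by lia|].
    by rewrite evalS rmorph0 horner0 mulr0 add0r normr1.
  have [z zP] := digit_exists (reach_le1 rp).
  have sz : size (p * 'X + (z : int)%:P) = k.+2.
    by rewrite size_MXaddC sp -size_poly_eq0 sp.
  exists (p * 'X + (z : int)%:P); split=> //.
    by apply: reachS => //; [exact: digit_valP|rewrite evalS].
  rewrite monicE /lead_coef sz /= coefD coefMX coefC /= addr0.
  by move: mp; rewrite monicE /lead_coef sp.
have [g gP] := boolp.choice H.
have [i [j [ij e]]] : exists i j, (i < j)%N /\ eval b (g i) = eval b (g j).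
  by apply: (pigeonhole_seq (s := s) (g := fun k => eval b (g k))) => k; apply: sP; case: (gP k).
have [[_ mi si] [_ mj sj]] := (gP i, gP j).
exists (g j - g i); last by apply/rootP; rewrite evalB e subrr.
by rewrite monicE lead_coefDl ?size_polyN ?si ?sj// -monicE.
Qed.

End Reach.

(** * Conjugates outside the open unit disc *)

(* Enestrom-Kakeya: multiply by 1 - alpha^-1 and use the equality case of the
   triangle inequality. *)
Lemma decreasing_poly_root (C : numClosedFieldType) (t : nat -> C) n alpha :
    (forall k, (k <= n)%N -> 0 < t k) -> (forall k, (k < n)%N -> t k.+1 < t k) ->
    1 <= `|alpha| ->
  \sum_(k < n.+1) t k * alpha ^+ (n - k) != 0.
Proof.
move=> t0 tS a1; apply/negP => /eqP E.
have a0 : alpha != 0 by rewrite -normr_gt0; apply: lt_le_trans a1.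
pose g := alpha^-1; have g1 : `|g| <= 1 by rewrite normfV invf_le1// normr_gt0.
have {E} E : \sum_(k < n.+1) t k * g ^+ k = 0.
  apply: (mulIf (expf_neq0 n a0)); rewrite mul0r -[RHS]E mulr_suml.
  apply: eq_bigr => k _; rewrite -mulrA; congr (_ * _).
  have kn : (k <= n)%N := ltn_ord k.
  have -> : alpha ^+ n = alpha ^+ (n - k) * alpha ^+ k by rewrite -exprD subnK.
  by rewrite /g exprVn mulrCA mulVf ?mulr1// expf_neq0.
pose s k := if (k <= n)%N then t k else 0.
have s_gt0 (k : 'I_n.+1) : 0 < s k by rewrite /s (ltn_ord k : (k <= n)%N) t0// -ltnS.
have sS k : (k <= n)%N -> s k.+1 < s k.
  by move=> kn; rewrite /s kn; case: ifP => [/tS//|_]; exact: t0.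
have {}E : \sum_(k < n.+1) s k * g ^+ k = 0.
  by rewrite -[RHS]E; apply: eq_bigr => k _; rewrite /s (ltn_ord k : (k <= n)%N).
have ES : \sum_(k < n.+1) s k.+1 * g ^+ k.+1 = - s 0%N.
  apply/eqP; rewrite -addr_eq0 addrC -[s 0%N]mulr1.
  have := E; rewrite -[X in X = _]addr0 => {}E.
  rewrite -(big_ord_recl n.+1 (fun k : 'I_n.+2 => s k * g ^+ k)) big_ord_recr /=.
  by rewrite /s ltnn mul0r; apply/eqP.
have F1 : \sum_(k < n.+1) (s k - s k.+1) * g ^+ k.+1 = \sum_(k < n.+1) (s k - s k.+1).
  under eq_bigr => k _ do rewrite mulrBl.
  rewrite sumrB ES opprK; under eq_bigr => k _ do rewrite exprS mulrCA.
  rewrite -mulr_sumr E mulr0 add0r; under eq_bigr => k _ do rewrite -opprB.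
  by rewrite sumrN -(big_mkord xpredT (fun k => s k.+1 - s k)) telescope_sumr// opprB /s ltnn subr0.
have F2 (k : 'I_n.+1) : true -> `|(s k - s k.+1) * g ^+ k.+1| <= s k - s k.+1.
  move=> _; have sk : 0 <= s k - s k.+1 by rewrite subr_ge0 ltW// sS// -ltnS.
  by rewrite normrM normrX ger0_norm// ler_piMr// exprn_ile1.
have := normC_sum_upper F2 F1 (i := ord0) isT; rewrite expr1 -[RHS]mulr1.
move=> /mulfI g_1; have {g_1} g_1 : g = 1 by apply: g_1; rewrite subr_eq0 gt_eqF// sS.
move: E; under eq_bigr => k _ do rewrite g_1 expr1n mulr1.
move=> E0; have := s_gt0 ord0; rewrite (psumr_eq0P _ E0) ?ltxx// => k _.
exact: ltW.
Qed.

Section Conjugate.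
Context {R : realType} (b : R) (M : nat) (alpha : R[i]).
Hypotheses (b1 : 1 < b) (bM : b < M.+1%:R).
Hypothesis conj0 : forall p : {poly int}, eval b p = 0 -> eval alpha p = 0.
Hypotheses (ab : alpha != b%:C) (a1 : 1 <= `|alpha|).
Let b0 : 0 < b. Proof. exact: lt_trans b1. Qed.
Let M0 : (0 < M)%N.
Proof. by case: M bM => // h; have := lt_trans b1 h; rewrite ltxx. Qed.
Let M1 : 1 <= M%:R :> R. Proof. by rewrite ler1n. Qed.
Let bM' : b < M%:R + 1. Proof. by rewrite -mulrSr. Qed.

Local Notation reach := (reach b M).

Lemma conj_eq p q : eval b p = eval b q -> eval alpha p = eval alpha q.
Proof.
by move=> e; apply/eqP; rewrite -subr_eq0 -evalB conj0// evalB e subrr.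
Qed.

Lemma reach1 : reach 1.
Proof.
rewrite -[1]addr0 addrC -{1}(mul0r 'X) -polyC1; apply: reachS; [exact: reach0|by move: M0; clear; lia|].
by rewrite evalS rmorph0 horner0 mulr0 add0r normr1.
Qed.

(** With v the value of q at b, the values of q and q - 1 are the two displacements of the rotation
    of [0, 1) by v. *)
Definition consecutive q := [/\ reach q, reach (q - 1) & 0 < eval b q < 1].

Lemma consecutive_step p (z : int) : reach p -> - M%:Z < z <= M%:Z ->
  0 < b * eval b p + z%:~R < 1 -> consecutive (p * 'X + z%:P).
Proof.
move=> rp zM; rewrite -evalS => /andP[z0 z1].
have E : p * 'X + z%:P - 1 = p * 'X + (z - 1)%:P by rewrite polyCB addrA.
split; last exact/andP.
- apply: reachS => //; [by move: zM; clear; lia|by rewrite ger0_norm ltW].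
- rewrite E; apply: reachS => //; first by move: zM; clear; lia.
  rewrite -E evalB rmorph1 hornerC ler_norml; apply/andP; split; lra.
Qed.

(* If q is fixed by conjugation, the fractional part of b e, with e = q or q - 1
   and |e| <= 1/2, is not. *)
Lemma consecutive_not_fixed q : consecutive q ->
  exists2 q', consecutive q' & eval alpha q' != (eval b q')%:C.
Proof.
move=> cq; have [fix_q|] := eqVneq (eval alpha q) (eval b q)%:C; last by exists q.
have [e [re e0 e2 fix_e]] : exists e,
    [/\ reach e, eval b e != 0, `|eval b e| <= 1 / 2 & eval alpha e = (eval b e)%:C].
  case: cq => rq rq1 /andP[q0 q1].
  have [h|h] := leP (eval b q) (1 / 2).
    by exists q; split; rewrite ?gt_eqF// ger0_norm// ltW.
  exists (q - 1); split=> //; rewrite ?evalB ?rmorph1 ?hornerC.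
  - by rewrite lt_eqF// subr_lt0.
  - by rewrite ler0_norm; lra.
  - by rewrite fix_q rmorphB/= rmorph1.
set y := b * eval b e; have [fl fu] := (floor_le y, floorD1_gt y).
(* Hence |y| < (M + 1) / 2 <= M, so minus the floor of y lies in (-M, M], as [consecutive_step]
   requires. *)
have y2 : `|y| <= b / 2 by rewrite normrM (gtr0_norm b0) ler_pM2l// -[2^-1]mul1r.
have fM : Num.floor y < M%:Z.
  rewrite -(ltr_int R); apply: le_lt_trans fl _; apply: le_lt_trans (ler_norm _) _.
  by rewrite -[M%:Z%:~R]/(M%:R); move: y2 M1 bM'; move: (M%:R : R) `|y| => m z; lra.
have fM' : - M%:Z <= Num.floor y.
  rewrite floor_ge_int mulrNz -[M%:Z%:~R]/(M%:R).
  by move: y2 M1 bM'; rewrite ler_norml => /andP[+ _]; move: (M%:R : R) => m; lra.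
pose q' := e * 'X + (- Num.floor y)%:P.
have aq' : eval alpha q' = alpha * (eval b e)%:C - (Num.floor y)%:~R.
  by rewrite evalS fix_e mulrNz.
have bq' : eval b q' = y - (Num.floor y)%:~R by rewrite evalS mulrNz.
have e0C : (eval b e)%:C != 0 :> R[i] by rewrite (fmorph_eq0 (real_complex R)).
have aq'N : eval alpha q' != (eval b q')%:C.
  rewrite aq' bq' rmorphB rmorphM/= rmorph_int.
  by rewrite (inj_eq (addIr _)) (inj_eq (mulIf e0C)).
exists q'; last exact: aq'N.
apply: consecutive_step re _ _.
  by move: fM fM'; move: (Num.floor y) => z; clear; lia.
rewrite mulrNz -/y; move: fu; rewrite intrD => fu; apply/andP; split; last by lra.
(* If y were an integer, q' would vanish at b, hence at alpha, and would be fixed. *)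
rewrite subr_gt0 lt_neqAle fl andbT; apply: contraNneq aq'N => yz.
have q'0 : eval b q' = 0 by rewrite bq' yz subrr.
by rewrite q'0 (conj0 q'0).
Qed.

(** X^k - M X^(k-1) - ... - M: the remainder of 1 after k digits M. *)
Fixpoint quasi k : {poly int} := if k is k.+1 then quasi k * 'X + (- M%:Z)%:P else 1.
Let t k := eval b (quasi k).
Let tS k : t k.+1 = b * t k - M%:R.
Proof. by rewrite /t /= evalS mulrNz. Qed.
Let t0 : t 0 = 1. Proof. by rewrite /t /= rmorph1 hornerC. Qed.

(* As long as the greedy digits of 1 are maximal, the remainders t_k decrease.  If
   the greedy expansion of 1 is M M ... M a, then b is a root of
   (X - b) \sum_k t_k X^(n-k), whose second factor has all its roots in the open
   unit disc, so there is no room for alpha. *)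
Lemma exists_consecutive : exists q, consecutive q.
Proof.
(* As 1 - t_(k+1) = (M + 1 - b) + b (1 - t_k) with M + 1 - b > 0, the t_k eventually become
   negative. *)
have ex : exists k, b * t k <= M%:R.
  have [k hk] := exp_unbounded b1 1 (etrans (subr_gt0 b _) bM').
  exists k.+1; suff : 1 - t k.+1 >= (M%:R + 1 - b) * b ^+ k.
    move=> h; have : b * t k.+1 <= 0 by rewrite pmulr_rle0//; lra.
    by move=> /le_trans; apply.
  elim: k {hk} => [|k IH]; first by rewrite tS t0 expr0 !mulr1; move: (M%:R : R) => m; lra.
  rewrite tS exprS mulrCA; have := ler_wpM2l (ltW b0) IH; rewrite mulrBr mulr1.
  move: (b * (_ * b ^+ k)) (b * t k.+1) bM'; move: (M%:R : R) => m u u' h h'; lra.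
have [n nP nmin] := ex_minnP ex.
have big k : (k < n)%N -> M%:R < b * t k.
  by move=> kn; rewrite ltNge; apply: contraL kn => /nmin; rewrite leqNgt.
have tP k : (k <= n)%N -> [/\ reach (quasi k), 0 < t k & t k <= 1].
  elim: k => [_|k IH kn]; first by rewrite t0; split=> //; exact: reach1.
  have [rk tk0 tk1] := IH (ltnW kn); have := big _ kn => bk.
  have tk : 0 < t k.+1 <= 1.
    rewrite tS; have := ler_wpM2l (ltW b0) tk1; rewrite mulr1; move: bk bM'.
    by move: (M%:R : R) (b * t k) => m u *; apply/andP; split; lra.
  case/andP: tk => *; split=> //; apply: reachS => //; first by clear; lia.
  by rewrite -/(t k.+1) ger0_norm// ltW.
have tdec k : (k < n)%N -> t k.+1 < t k.
  move=> /ltnW/tP[_ h h']; rewrite tS -subr_gt0.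
  have -> : t k - (b * t k - M%:R) = M%:R - (b - 1) * t k by rewrite mulrBl mul1r; ring.
  rewrite subr_gt0; apply: le_lt_trans (_ : _ <= b - 1) _.
    by rewrite ler_piMr// subr_ge0 ltW.
  by rewrite ltrBlDr.
have [rn tn0 tn1] := tP _ (leqnn n).
set y := b * t n; have [fl fu] := (floor_le y, floorD1_gt y).
have f0 : 0 <= Num.floor y by rewrite floor_ge0 mulr_ge0// ltW.
have fM : Num.floor y <= M%:Z by rewrite -(ler_int R); exact: le_trans fl nP.
pose q := quasi n * 'X + (- Num.floor y)%:P.
have bq : eval b q = y - (Num.floor y)%:~R by rewrite evalS mulrNz.
have [yz|yz] := eqVneq y (Num.floor y)%:~R; last first.
  have fy : (Num.floor y)%:~R < y by rewrite lt_neqAle eq_sym yz.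
  have fM' : Num.floor y < M%:Z by rewrite -(ltr_int R); exact: lt_le_trans fy nP.
  exists q; apply: consecutive_step => //.
    by move: f0 fM'; move: (Num.floor y) => z; clear; lia.
  by rewrite -/(t n) -/y mulrNz subr_gt0 fy ltrBlDl; move: fu; rewrite intrD.
exfalso; have aq : eval alpha q = 0 by apply: conj0; rewrite bq -yz subrr.
have := @decreasing_poly_root _ (fun k => (t k)%:C) n alpha.
case/(_ _ _ _)/negP => // [k /tP[_ h _]|k /tdec h|]; rewrite ?ltr0c ?ltcR//.
(* The product telescopes; at j = n both terms on the right equal the integer y. *)
have H j : (alpha - b%:C) * (\sum_(k < j.+1) (t k)%:C * alpha ^+ (j - k)) =
    alpha * eval alpha (quasi j) - b%:C * (t j)%:C.
  elim: j => [|j IH].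
    by rewrite big_ord1 t0 /= !rmorph1 hornerC !mulr1.
  rewrite big_ord_recr/= subnn mulr1.
  under eq_bigr => k _ do rewrite subSn ?(ltn_ord k : (k <= j)%N)// exprS mulrCA.
  rewrite -mulr_sumr mulrDr mulrCA IH evalS tS rmorphB/= rmorphM/= mulrNz.
  rewrite rmorph_nat -[M%:Z%:~R]/(M%:R); ring.
have : (alpha - b%:C) * (\sum_(k < n.+1) (t k)%:C * alpha ^+ (n - k)) = 0.
  rewrite H -rmorphM/= -/y yz rmorph_int.
  by move: aq; rewrite evalS mulrNz.
by move/eqP; rewrite mulf_eq0 subr_eq0 (negbTE ab).
Qed.

(** A finite supply of interval ends, as soon as the reachable values are finite in number, that is
    stable under the maps x |-> b x - d. *)
Definition endpoint (x : R) := 0 <= x <= 1 /\ exists p q,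
  [/\ reach p, reach q, 0 <= eval b p & x = eval b p - eval b q].

(** Expand p along with x, with a digit d' in 0..M keeping it in [0, 1]. Then q follows by the digit
    d - d', which lies in -M..M, and stays in [-1, 1] as a difference of two points of [0, 1]. *)
Lemma endpointS x d : endpoint x -> (d <= M)%N -> 0 <= b * x - d%:R <= 1 ->
  endpoint (b * x - d%:R).
Proof.
move=> [x01 [p [q [rp rq p0 xE]]]] dM x'01; split=> //.
have p1 : eval b p <= 1 by apply: le_trans (reach_le1 rp); exact: ler_norm.
have [d' d'M d'P] : exists2 d' : nat, (d' <= M)%N & 0 <= b * eval b p - d'%:R <= 1.
  have y0 : 0 <= b * eval b p by rewrite mulr_ge0// ltW.
  have [h|h] := leP M%:R (b * eval b p).
    exists M => //; have := ler_wpM2l (ltW b0) p1; rewrite mulr1; move: h bM'.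
    by move: (M%:R : R) (b * _) => m u *; apply/andP; split; lra.
  have := floor_le (b * eval b p); have := floorD1_gt (b * eval b p).
  have := y0; rewrite -floor_ge0; case: (Num.floor _) => // n _.
  rewrite intrD -[n%:Z%:~R]/(n%:R) => hu hl; exists n.
    by rewrite ltnW// -(ltr_nat R) (le_lt_trans hl h).
  by rewrite subr_ge0 hl/= lerBlDl ltW.
exists (p * 'X + (- d'%:Z)%:P), (q * 'X + (d%:Z - d'%:Z)%:P).
have Ep : eval b (p * 'X + (- d'%:Z)%:P) = b * eval b p - d'%:R by rewrite evalS mulrNz.
have Eq : eval b (q * 'X + (d%:Z - d'%:Z)%:P) = b * eval b q + d%:R - d'%:R.
  by rewrite evalS intrB addrA.
case/andP: d'P => d0 d1; case/andP: x'01 => x'0 x'1.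
split.
- apply: reachS => //; [by move: d'M; clear; lia|by rewrite Ep ger0_norm].
- apply: reachS => //; [by move: dM d'M; clear; lia|rewrite Eq].
  by rewrite ler_norml; apply/andP; split; move: d0 d1 x'0 x'1; rewrite xE mulrBr; lra.
- by rewrite Ep.
- by rewrite Ep Eq xE; ring.
Qed.

Lemma endpoint1B p : reach p -> 0 <= 1 - eval b p <= 1 -> endpoint (1 - eval b p).
Proof.
move=> rp h; split=> //; exists 1, p; split=> //; first exact: reach1.
  by rewrite rmorph1 hornerC.
by rewrite rmorph1 hornerC.
Qed.

Lemma endpointN p : reach p -> 0 <= - eval b p <= 1 -> endpoint (- eval b p).
Proof.
move=> rp h; split=> //; exists 0, p; split=> //; first exact: reach0.
  by rewrite rmorph0 horner0.
by rewrite rmorph0 horner0 sub0r.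
Qed.

Lemma endpoint0 : endpoint 0.
Proof.
have := @endpointN 0 (@reach0 _ _ _); rewrite rmorph0 horner0 oppr0; apply.
by rewrite lexx ler01.
Qed.

Lemma endpoint1 : endpoint 1.
Proof.
have := @endpoint1B 0 (@reach0 _ _ _); rewrite rmorph0 horner0 subr0; apply.
by rewrite lexx ler01.
Qed.

Definition admissible (s : @ovstate R) :=
  [/\ overlap s.1.1 s.1.2 s.2.1, endpoint s.1.1, endpoint s.1.2 &
      exists2 p, reach p & s.2 = (eval b p, eval alpha p)].

(** With q the new displacement, each new end is 0 or 1, the image of an old end, or one of -q(b)
    and 1 - q(b). *)
Lemma admissible_child s (d d' : nat) : (d <= M)%N -> (d' <= M)%N ->
  admissible s -> 0 < ovlen (child b alpha s d d') -> admissible (child b alpha s d d').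
Proof.
move=> dM d'M; case: s => [[l r] [x y]] [ov el er [p rp [-> ->]]].
rewrite /ovlen subr_gt0 /= => lt; have ov' := overlap_child lt.
have Ev (K : comNzRingType) (z : K) :
    eval z (p * 'X + (d%:Z - d'%:Z)%:P) = z * eval z p + d%:R - d'%:R.
  by rewrite evalS intrB addrA.
pose q := p * 'X + (d%:Z - d'%:Z)%:P.
move: (ov'); rewrite /overlap /= => /and5P[_ l0 r1 lx rx].
have rq : reach q.
  apply: reachS => //; first by move: dM d'M; clear; lia.
  by rewrite Ev ler_norml; apply/andP; split; lra.
split=> //=; last by exists q => //; rewrite !Ev.
- have lo01 : 0 <= ovl b l (eval b p) d d' <= 1 by lra.
  move: lo01; rewrite /ovl -Ev -/q.
  case: (leP (Num.max (b * l - d%:R) 0) (- eval b q)) => _ h; first exact: (endpointN rq h).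
  by move: h; case: (leP (b * l - d%:R) 0) => _ h; [exact: endpoint0|exact: (endpointS el)].
- have hi01 : 0 <= ovr b r (eval b p) d d' <= 1 by lra.
  move: hi01; rewrite /ovr -Ev -/q.
  case: (leP (Num.min (b * r - d%:R) 1) (1 - eval b q)) => _ h; last exact: (endpoint1B rq h).
  by move: h; case: (leP (b * r - d%:R) 1) => _ h; [exact: (endpointS er)|exact: endpoint1].
Qed.

Lemma admissible_finite (s : seq R) : (forall p, reach p -> eval b p \in s) ->
  exists L, uniq L /\ forall st, st \in L <-> admissible st.
Proof.
move=> sP.
(* A reachable value determines its conjugate, so the fourth component of a state adds no new
   choices. *)
pose f x : R[i] := xget 0 [set y | exists2 p, reach p & eval b p = x /\ eval alpha p = y].
have fP p : reach p -> f (eval b p) = eval alpha p.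
  move=> rp; rewrite /f; case: xgetP => [_ _ [q rq [e <-]]|/(_ (eval alpha p))]; first exact: conj_eq.
  by case; exists p.
pose P := [seq x - y | x <- s, y <- s].
exists (undup [seq st <- [seq (lr, (x, f x)) | lr <- [seq (l, r) | l <- P, r <- P], x <- s]
          | `[< admissible st >]]).
split; first exact: undup_uniq.
move=> st; rewrite mem_undup mem_filter; split=> [/andP[/asboolP]//|ast].
apply/andP; split; first exact/asboolP.
case: st ast => [[l r] [x y]] [_ [_ [p [q [rp rq _ lE]]]] [_ [p' [q' [rp' rq' _ rE]]]] [e re]].
case=> -> ->; rewrite -fP//; apply: (allpairs_f (fun lr x => (lr, (x, f x)))); last exact: sP.
apply: (allpairs_f pair).
  by move: lE => /= ->; apply: (allpairs_f (fun x y => x - y)); exact: sP.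
by move: rE => /= ->; apply: (allpairs_f (fun x y => x - y)); exact: sP.
Qed.

Lemma conjugate_root_of_unity (s : seq R) : (forall p, reach p -> eval b p \in s) ->
  exists2 m, (0 < m)%N & alpha ^+ m = 1.
Proof.
move=> /admissible_finite[L [Lu LP]].
have [q0 /consecutive_not_fixed[q [rq rq1 /andP[v0 v1]] qN]] := exists_consecutive.
set v := eval b q in v0 v1 qN; set y := eval alpha q in qN.
have s1 : admissible (0, 1 - v, (v, y)).
  split=> /=; [|exact: endpoint0|by apply: endpoint1B => //; rewrite -/v; lra|by exists q].
  by rewrite /overlap; apply/and5P; split; lra.
have s2 : admissible (1 - v, 1, (v - 1, y - 1)).
  split=> /=; [|by apply: endpoint1B => //; rewrite -/v; lra|exact: endpoint1|].
    by rewrite /overlap; apply/and5P; split; lra.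
  by exists (q - 1) => //; rewrite !evalB !rmorph1 !hornerC.
apply: (overlap_root_of_unity b0 (ltW bM) Lu _ _ (proj2 (LP _) s1) a1 qN).
- by move=> st /LP[].
- by move=> st d d' /LP ast lt; apply/LP; apply: admissible_child => //; rewrite -ltnS ltn_ord.
- exact: (proj2 (LP _) s1).
- exact: (proj2 (LP _) s2).
Qed.

End Conjugate.

(** * Residues modulo the minimal polynomial *)

Section MinimalPolynomials.
Context {K : numFieldType}.
Implicit Types (x : K) (p q : {poly rat}).

Lemma irreducible_root p q x : irreducible_poly p ->
  root (map_poly ratr p) x -> root (map_poly ratr q) x -> p %| q.
Proof.
move=> irr px qx; apply: contraT; rewrite -(irreducible_poly_coprime q irr).
by rewrite -(coprimep_map (@ratr K)) => /coprimep_root/(_ px); rewrite -rootE qx.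
Qed.

Lemma dvdp_ratr_root p q x : p %| q -> root (map_poly ratr p) x -> root (map_poly ratr q) x.
Proof. by case/dvdpP => c ->; rewrite rmorphM rootM orbC => ->. Qed.

Lemma ratr_intr_poly (P : {poly int}) :
  map_poly (@ratr K) (map_poly intr P) = map_poly intr P.
Proof. by apply/polyP => i; rewrite !coef_map/= ratr_int. Qed.

Lemma minimal_irreducible p x : p != 0 -> root (map_poly ratr p) x ->
    (forall q, q != 0 -> root (map_poly ratr q) x -> (size p <= size q)%N) ->
  irreducible_poly p.
Proof.
move=> p0 px pmin; split.
  rewrite ltnNge; apply: contraL px => /size1_polyC pE.
  by rewrite pE map_polyC rootC/= fmorph_eq0; apply: contraNneq p0 => c0; rewrite pE c0 polyC0.
move=> q q1 /dvdpP[r pE]; move: (p0); rewrite pE mulf_eq0 negb_or => /andP[r0 q0].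
move: px; rewrite pE rmorphM rootM => /orP[rx|qx].
  have := pmin r r0 rx; rewrite pE size_mul// -subn1 leq_subLR addnC.
  rewrite leq_add2r => q2; have : (0 < size q)%N by rewrite size_poly_gt0.
  by move: q1 q2; case: (size q) => [|[]].
rewrite -pE -dvdp_size_eqp; last by rewrite pE dvdp_mull.
by rewrite eqn_leq pmin// andbT dvdp_leq// pE dvdp_mull.
Qed.

Lemma integral_minimal_poly x : integralOver (intr : int -> K) x ->
  exists m : {poly int},
    [/\ m \is monic, irreducible_poly (map_poly intr m : {poly rat}) & eval x m = 0].
Proof.
move=> [g mg /rootP gx].
have g0 : map_poly intr g != 0 :> {poly rat} by rewrite monic_neq0// monic_map.
have ex : exists n, `[< exists p : {poly rat},
    [/\ p != 0, root (map_poly ratr p) x & size p = n] >].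
  exists (size (map_poly intr g : {poly rat})); apply/asboolP.
  by exists (map_poly intr g); split=> //; apply/rootP; rewrite ratr_intr_poly.
have [_ /asboolP[p [p0 px <-]] pmin] := ex_minnP ex.
have {}pmin q : q != 0 -> root (map_poly ratr q) x -> (size p <= size q)%N.
  by move=> q0 qx; apply: pmin; apply/asboolP; exists q.
have irr := minimal_irreducible p0 px pmin.
have : p %| map_poly intr g.
  by apply: irreducible_root irr px _; apply/rootP; rewrite ratr_intr_poly.
case/dvdpP_rat_int => p1 [c c0 pE] [r gE].
(* Both leading coefficients are therefore the same unit of the integers, and scaling [p1] by it
   makes it monic. *)
have lr : lead_coef r * lead_coef p1 = 1.
  by rewrite mulrC -lead_coefM -gE; apply/eqP.
have r0 : lead_coef r != 0 by apply: contra_eq_neq lr => ->; rewrite mul0r eq_sym oner_eq0.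
exists (lead_coef r *: p1); rewrite monicE lead_coefZ lr eqxx.
have mE : map_poly intr (lead_coef r *: p1) = ((lead_coef r)%:~R / c) *: p :> {poly rat}.
  by rewrite pE scalerA divfK// map_polyZ.
have s0 : (lead_coef r)%:~R / c != 0 by rewrite mulf_neq0 ?invr_eq0// intr_eq0.
have mx : root (map_poly ratr (map_poly intr (lead_coef r *: p1))) x.
  by rewrite mE map_polyZ rootZ// fmorph_eq0.
split=> //; last by move/rootP: mx; rewrite ratr_intr_poly.
apply: (minimal_irreducible _ mx); first by rewrite mE scaler_eq0 negb_or s0.
by move=> q q0 qx; rewrite mE size_scale// pmin.
Qed.

End MinimalPolynomials.

Lemma norm_real_complex (R : rcfType) (x : R) : `|x%:C| = `|x|%:C :> R[i].
Proof. by rewrite normc_def/= expr0n addr0 sqrtr_sqr. Qed.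

Section Residues.
Context {R : rcfType}.
Let C : numClosedFieldType := R[i].
Implicit Types (z : C) (zs : seq C) (u : nat -> C).

(** The value at z of \sum_(i < n) u_i X^(n-1-i), in Horner form. *)
Fixpoint conv z u n : C := if n is n.+1 then z * conv z u n + u n else 0.

(* Newton form, at the nodes zs, of the polynomial \sum_(i < n) u_i X^(n-1-i)
   reduced modulo \prod_(z <- zs) (X - z): its coefficients in the Newton basis
   satisfy c_(n+1) = z c_n + (previous coefficient), so they stay bounded when
   the nodes lie in the open unit disc. *)
Fixpoint newton zs u n : {poly C} :=
  if zs is z :: zs then (conv z u n)%:P + ('X - z%:P) * newton zs (conv z u) n else 0.

Lemma newton0 zs u : newton zs u 0 = 0.
Proof. by elim: zs u => //= z zs IH u; rewrite IH mulr0 addr0. Qed.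

Lemma size_newton zs u n : (size (newton zs u n) <= size zs)%N.
Proof.
elim: zs u => [|z zs IH] u /=; first by rewrite size_poly0.
apply: leq_trans (size_polyD _ _) _; rewrite geq_max (leq_trans (size_polyC_leq1 _))//.
have [->|nz] := eqVneq (newton zs (conv z u) n) 0; first by rewrite mulr0 size_poly0.
by rewrite size_mul ?polyXsubC_eq0// size_XsubC/= ltnS.
Qed.

(** X (c + (X - z) N) + u = (z c + u) + (X - z) (X N + c): the first coefficient c becomes the
    letter read by the remaining nodes. *)
Lemma newtonS zs u n : exists k,
  newton zs u n * 'X + (u n)%:P = newton zs u n.+1 + k *: \prod_(z <- zs) ('X - z%:P).
Proof.
elim: zs u => [|z zs IH] u.
  by exists (u n); rewrite big_nil mul0r !add0r alg_polyC.
have [k E] := IH (conv z u); exists k; rewrite big_cons /= polyCD polyCM.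
have {}E : newton zs (conv z u) n.+1 =
   newton zs (conv z u) n * 'X + (conv z u n)%:P - k *: \prod_(j <- zs) ('X - j%:P).
  by rewrite E addrK.
rewrite [newton zs _ n.+1]E scalerAr; move: (k *: _) => P.
ring.
Qed.

Lemma conv_bounded z (K : R) : `|z| < 1 -> exists B : R, forall u,
  (forall n, `|u n| <= K%:C) -> forall n, `|conv z u n| <= B%:C.
Proof.
have [r rE] : exists r : R, `|z| = r%:C by exists (ComplexField.Normc.normc z).
rewrite rE ltcR => r1; have r0 : 0 <= r by rewrite -ler0c -rE.
exists (K / (1 - r)) => u uK.
have K0 : 0 <= K by rewrite -ler0c (le_trans _ (uK 0%N)).
elim=> [|n IH] /=; first by rewrite normr0 ler0c divr_ge0// subr_ge0 ltW.
have -> : K / (1 - r) = r * (K / (1 - r)) + K by field; rewrite subr_eq0 gt_eqF.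
rewrite rmorphD rmorphM/= -rE (le_trans (ler_normD _ _))// lerD// normrM.
by rewrite ler_wpM2l.
Qed.

(** No bound on z is assumed, so this applies also to the node b outside the unit disc. *)
Lemma coef_newton_step z (K B : R) (p : {poly C}) (c : C) :
    (forall i, `|p`_i| <= K%:C) -> `|c| <= B%:C -> forall i,
  `|(c%:P + ('X - z%:P) * p)`_i| <= B%:C + K%:C + `|z| * K%:C.
Proof.
move=> pK cB i; rewrite coefD mulrBl coefB coefCM coefXM coefC.
have K0 : 0 <= K%:C by apply: le_trans (pK 0%N).
have B0 : 0 <= B%:C by apply: le_trans cB.
apply: le_trans (ler_normD _ _) _; rewrite -addrA lerD//.
  by case: ifP => _; rewrite ?normr0.
apply: le_trans (ler_normB _ _) _; rewrite lerD// ?normrM ?ler_wpM2l//.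
by case: ifP => _; rewrite ?normr0.
Qed.

Lemma newton_bounded zs (K : R) : (forall z, z \in zs -> `|z| < 1) ->
  exists B : R, forall u, (forall n, `|u n| <= K%:C) ->
    forall n i, `|(newton zs u n)`_i| <= B%:C.
Proof.
elim: zs K => [|z zs IH] K zs1.
  by exists 0 => u _ n i; rewrite coef0 normr0.
have [B HB] := conv_bounded K (zs1 z (mem_head _ _)).
have [D HD] : exists D : R, forall u, (forall n, `|u n| <= B%:C) ->
    forall n i, `|(newton zs u n)`_i| <= D%:C.
  by apply: IH => y yzs; rewrite zs1// in_cons yzs orbT.
exists (B + D + ComplexField.Normc.normc z * D) => u uK n i.
rewrite !rmorphD rmorphM/=; apply: coef_newton_step => [j|]; last exact: HB.
by apply: HD => k; exact: HB.
Qed.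

End Residues.

Lemma int_poly_finite d (K : nat) : exists L : seq {poly int}, forall p : {poly int},
  (size p <= d)%N -> (forall i, `|p`_i| <= K%:Z) -> p \in L.
Proof.
elim: d => [|d [L HL]].
  by exists [:: 0] => p; rewrite leqn0 size_poly_eq0 => /eqP -> _; rewrite mem_head.
pose zs := [seq n%:Z - K%:Z | n <- iota 0 (K + K).+1].
exists [seq q * 'X + z%:P | q <- L, z <- zs] => p sp pK.
have -> : p = drop_poly 1 p * 'X + (p`_0)%:P.
  apply/polyP => i; rewrite coefD coefMX coef_drop_poly coefC.
  by case: i => [|i] /=; rewrite ?add0r// addn1 addr0.
apply: (allpairs_f (fun q z => q * 'X + z%:P)).
  apply: HL => [|i]; last by rewrite coef_drop_poly.
  by rewrite size_drop_poly leq_subLR.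
apply/mapP; exists (absz (p`_0 + K%:Z)%R); last by have := pK 0%N; lia.
by rewrite mem_iota; have := pK 0%N; lia.
Qed.

(** The states are the elements of L, all terminal, and transitions leaving L are dropped: accepting
    means having an infinite run. *)
Lemma deterministic_buchi (B : finType) (T : choiceType) (L : seq T)
    (step : T -> B -> T) (t0 : T) : t0 \in L ->
  let run := fix run (w : nat -> B) n := if n is n.+1 then step (run w n) (w n) else t0 in
  buchi_recognizable [set w : nat -> B | forall n, run w n \in L].
Proof.
move=> t0L run.
exists (@FiniteAutomaton B (seq_sub L)
   (finset (fun e => val e.2 == step (val e.1.1) e.1.2))
   (finset (pred1 (SeqSub t0L))) (finset predT)).
apply/seteqP; split=> [w [q pq [q0 _]] n | w wL].
  suff -> : run w n = val (q n) by exact: valP.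
  elim: n => [|n IH] /=; first by move: q0; rewrite inE => /eqP ->.
  by have := pq n; rewrite inE /= IH => /eqP.
exists (fun n => SeqSub (wL n)) => [n|]; first by rewrite inE.
by split=> [|n]; [rewrite inE; exact/eqP/val_inj|exists n; rewrite ?inE].
Qed.

(** * The implications between recognizability and the Pisot property *)

Section Main.
Context {R : realType} (b : R).
Hypothesis b1 : 1 < b.
Let b0 : 0 < b. Proof. exact: lt_trans b1. Qed.

Lemma conjugate_eval (z : R[i]) (p : {poly int}) : galois_conjugate b z ->
  (eval b p = 0) <-> (eval z p = 0).
Proof.
move=> [q [_ irr qb] qz]; split=> /rootP px; apply/rootP; move: px.
  rewrite -ratr_intr_poly => /(irreducible_root irr qb)/dvdp_ratr_root/(_ qz).
  by rewrite ratr_intr_poly.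
rewrite -ratr_intr_poly => /(irreducible_root irr qz)/dvdp_ratr_root/(_ qb).
by rewrite ratr_intr_poly.
Qed.

Lemma recognizable_pisot M : b <= M.+1%:R -> buchi_recognizable (zero_words b M) -> pisot b.
Proof.
move=> bM rec; have [s sP] := buchi_reach_finite b1 bM rec.
have M0 : (0 < M)%N by case: M bM {rec s sP} => // /(lt_le_trans b1); rewrite ltxx.
split=> //; first exact: reach_integral M0 sP.
move=> z cz zb; rewrite real_ltNge ?normr_real ?real1//; apply/negP => z1.
have conj0 p : eval b p = 0 -> eval z p = 0 by move/(conjugate_eval p cz).
(* If b were the integer M + 1, it would be its own only conjugate. *)
have {}bM : b < M.+1%:R.
  rewrite lt_neqAle bM andbT; apply: contraNneq zb => bE.
  have := conj0 ('X - M.+1%:Z%:P); rewrite !evalB !evalC !map_polyX !hornerX.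
  rewrite bE subrr => /(_ erefl)/eqP; rewrite subr_eq0 => /eqP ->.
  by rewrite rmorph_nat.
have [m m0 zm] := conjugate_root_of_unity b1 bM conj0 zb z1 sP.
(* The relation z^m = 1 transfers to b, which is greater than 1. *)
have : eval z ('X^m - 1) = 0 by rewrite evalB evalXn rmorph1 hornerC zm subrr.
move/(conjugate_eval _ cz); rewrite evalB evalXn rmorph1 hornerC => /eqP.
by rewrite subr_eq0 gt_eqF// exprn_egt1// -lt0n.
Qed.

(** A double root would be shared with the derivative, which is nonzero and of smaller degree than
    the irreducible m. *)
Lemma irreducible_simple_root (m : {poly int}) (zs : seq R[i]) :
    irreducible_poly (map_poly intr m : {poly rat}) ->
    map_poly intr m = \prod_(z <- b%:C :: zs) ('X - z%:P) ->
  b%:C \notin zs.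
Proof.
move=> irr mE; apply/negP => /(perm_to_rem) pz.
have m0 : map_poly intr m != 0 :> {poly rat}.
  by apply: contraTneq irr.1 => ->; rewrite size_poly0.
have mb : root (map_poly ratr (map_poly intr m : {poly rat})) b%:C.
  by rewrite ratr_intr_poly mE root_prod_XsubC mem_head.
have mb' : root (map_poly ratr (map_poly intr m : {poly rat})^`()) b%:C.
  rewrite -deriv_map ratr_intr_poly mE big_cons (perm_big _ pz) big_cons /=.
  by rewrite /root !derivM derivXsubC !hornerE subrr; apply/eqP; ring.
have /dvdp_leq := irreducible_root irr mb mb'.
have s1 := irr.1.
rewrite leqNgt lt_size_deriv// => /(_ _)/negP h; apply: h => //.
apply/eqP => /(congr1 (fun p : {poly rat} => p`_(size (map_poly intr m : {poly rat})).-2)).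
rewrite coef_deriv coef0 => /eqP; rewrite -mulr_natr mulf_eq0 pnatr_eq0 orbF.
have -> : (size (map_poly intr m : {poly rat})).-2.+1 = (size (map_poly intr m : {poly rat})).-1.
  by move: s1; case: (size _) => [|[]].
by rewrite -/(lead_coef _) lead_coef_eq0 (negbTE m0).
Qed.

Lemma pisot_recognizable M : pisot b -> buchi_recognizable (zero_words b M).
Proof.
move=> [_ /integral_minimal_poly[m [mm irr mb]] conj1].
have [zs0 mE0] := closed_field_poly_normal (map_poly intr m : {poly R[i]}).
rewrite lead_coef_map_eq ?intr_eq0 ?lead_coef_eq0 ?monic_neq0// in mE0.
rewrite (monicP mm) scale1r in mE0.
have mbC : root (map_poly intr m) b%:C.
  apply/rootP; rewrite -[RHS](rmorph0 (real_complex R)) -mb -horner_map/=.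
  by congr (_.[_]); apply/polyP => i; rewrite !coef_map/= rmorph_int.
move: (mbC); rewrite mE0 root_prod_XsubC => /perm_to_rem pz.
set zs := rem _ _ in pz; have mE : map_poly intr m = \prod_(z <- b%:C :: zs) ('X - z%:P).
  by rewrite mE0 (perm_big _ pz).
have bzs := irreducible_simple_root irr mE.
have zs1 z : z \in zs -> `|z| < 1.
  move=> zzs; apply: conj1; last by apply: contraNneq bzs => <-.
  exists (map_poly intr m).
    by split=> //; [exact: monic_map|apply/rootP; rewrite ratr_intr_poly].
  by rewrite ratr_intr_poly mE root_prod_XsubC in_cons zzs orbT.
pose d := size zs; have sm : size m = d.+2.
  have /(congr1 size) := congr1 polyseq mE.
  by rewrite size_prod_XsubC size_map_inj_poly//; exact: intr_inj.
(* As m is monic of degree d + 1, this removes the only coefficient that leaves the residues of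
   degree at most d. *)
pose step (p : {poly int}) (z : digit M) := p * 'X + (z : int)%:P - p`_d *: m.
pose res := fix res (w : nat -> digit M) n := if n is n.+1 then step (res w n) (w n) else 0.
have resE w n : map_poly intr (res w n) =
    newton (b%:C :: zs) (fun i => (w i : int)%:~R) n.
  elim: n => [|n IH]; first by rewrite newton0 rmorph0.
  have [k E] := newtonS (b%:C :: zs) (fun i => (w i : int)%:~R) n.
  have kE : k = ((res w n)`_d)%:~R.
    have := size_newton (b%:C :: zs) (fun i => (w i : int)%:~R) n.+1.
    move: E; rewrite -mE -IH; move: (newton _ _ n.+1) => N E sN.
    have := congr1 (fun p : {poly R[i]} => p`_d.+1) E.
    rewrite !coefD coefMX coefC addr0 coefZ !coef_map /= => ->.
    rewrite [X in X + _]nth_default ?add0r//.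
    by have := monicP mm; rewrite /lead_coef sm => -> /=; rewrite mulr1.
  have {}E : newton (b%:C :: zs) (fun i => (w i : int)%:~R) n.+1 =
      map_poly intr (res w n) * 'X + ((w n : int)%:~R)%:P - k *: map_poly intr m.
    by rewrite IH E -mE addrK.
  by rewrite E /= /step rmorphB rmorphD rmorphM/= map_polyX map_polyC map_polyZ kE.
have resb w n : eval b (res w n) = eval b (pol (fun i => w i : int) n).
  elim: n => [//|n IH]; rewrite /= /step evalB !evalS IH.
  by rewrite -mul_polyC evalM mb mulr0 subr0.
have [B HB] := newton_bounded (M%:R / (b - 1)) zs1.
set c := M%:R / (b - 1) in HB.
pose K := Num.bound `|c + B + b * B|.
have [L HL] := int_poly_finite d.+1 K.
have zeroL w : zero_words b M w -> forall n, res w n \in L.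
  move=> wz n; apply: HL.
    rewrite -(@size_map_inj_poly _ _ (intr : int -> R[i]))//; last exact: intr_inj.
    by rewrite resE; exact: size_newton.
  have convE k : conv b%:C (fun i => (w i : int)%:~R) k = (eval b (pol (fun i => w i : int) k))%:C.
    elim: k => [|k IH]; first by rewrite /= rmorph0 horner0.
    by rewrite /= IH evalS rmorphD rmorphM/= rmorph_int.
  have cb k : `|conv b%:C (fun i => (w i : int)%:~R) k| <= c%:C.
    rewrite convE norm_real_complex lecR; exact: zero_words_bounded.
  move=> i; rewrite -(ler_int R) -[K%:Z%:~R]/(K%:R) intr_norm.
  have bound := archi_boundP (normr_ge0 (c + B + b * B)).
  apply: le_trans (ltW bound); apply: le_trans (ler_norm _).
  (* At the node b, boundedness comes from the word having value 0; at the other nodes, from their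
     lying in the unit disc. *)
  have := coef_newton_step (b%:C) (HB _ cb n) (cb n) i.
  rewrite -[X in polyseq X]/(newton (b%:C :: zs) (fun i => (w i : int)%:~R) n) -resE coef_map /=.
  have intC (k : int) : k%:~R = (k%:~R)%:C :> R[i] by rewrite rmorph_int.
  by rewrite intC !norm_real_complex (gtr0_norm b0) -rmorphM -!rmorphD/= lecR.
have L0 : 0 \in L by apply: HL => [|i]; rewrite ?size_poly0// coef0 normr0.
have [A recA] := deterministic_buchi step L0.
exists A; rewrite recA; apply/seteqP; split=> w /= wP; last exact: zeroL.
(* A run inside L takes finitely many values at b; the sum of their moduli bounds each of them. *)
apply: (@bounded_zero_words _ _ _ b1 _ (\sum_(p <- L) `|eval b p|)) => n.
rewrite -resb (big_rem _ (wP n))/= lerDl sumr_ge0//.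
Qed.

End Main.

Theorem theorem4p3 (R : realType) (beta : R) (hbeta : 1 < beta) :
  [<-> (forall M : nat, (0 < M)%N -> buchi_recognizable (zero_words beta M));
       (exists2 M : nat, Num.ceil beta - 1 <= M%:Z
                         & buchi_recognizable (zero_words beta M));
       pisot beta].
Proof.
tfae.
- move=> H; exists (absz (Num.ceil beta)); last first.
    by apply: H; rewrite absz_gt0 gt_eqF// ceil_gt0 (lt_trans ltr01).
  by rewrite (le_trans _ (ler_norm _))// gerBl.
- case=> M cM; apply: recognizable_pisot => //.
  rewrite mulrSr -[M%:R]/(M%:Z%:~R) -intrD1.
  by apply: le_trans (ceil_ge _) _; rewrite ler_int -lerBlDr.
- by move=> pb M _; exact: pisot_recognizable.
Qed.
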